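(* Let $T\in\mathbb N$ be a time horizon, let $A\ge2$ be the number of arms, let $B\ge0$, and let $\pi$ be a bandit strategy such that for every bandit instance $\mathbb E[n^q_T]\le B$. Then there exists a bandit instance for which $$\mathbb E[\mathrm{Reg}(T)]\ge\frac1{140}\min\left\{T\sqrt{\frac AB},\,T\right\}.$$
   Context: Bandit model with reward queries. A bandit instance is a tuple $(\nu_a)_{a=1}^A$ of probability distributions on $[0,1]$ with means $r(a)$. At each round $t$ the agent chooses an arm $a_t$ and $q_t\in\{0,1\}$; a reward $R_t\sim\nu_{a_t}$ is generated independently of other rounds, and the agent observes only $Y_t=R_t\cdot q_t$. A bandit strategy $\pi$ chooses $(a_{t+1},q_{t+1})$ as a measurable function of $I_t=(U_0,Y_1,U_1,\dots,Y_t,U_t)$, where $U_0,U_1,\dots$ are i.i.d. uniform on $[0,1]$ (internal randomization). $n^q_T=\sum_{t=1}^T\mathbf 1\{q_t=1\}$ is the number of queries and $\mathrm{Reg}(T)=\sum_{t=1}^T(\max_ar(a)-r(a_t))$. Convention: $A/0=+\infty$. *)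

(* Defs.v *)
From HB Require Import structures.
From mathcomp Require Import all_boot all_order all_algebra.
From mathcomp Require Import all_classical all_reals all_analysis.
From mathcomp Require Import measurable_realfun.

Set Implicit Arguments.
Unset Strict Implicit.
Unset Printing Implicit Defensive.

Import Order.TTheory GRing.Theory Num.Theory.

Local Open Scope classical_set_scope.
Local Open Scope ring_scope.

(* Arms are the elements of 'I_A. *)
Record bandit_instance (R : realType) (A : nat) := BanditInstance {
  reward_law :> 'I_A -> probability (measurableTypeR R) R ;
  reward_law_itv : forall a, reward_law a `[0, 1]%classic = 1%E }.

Definition mean_reward (R : realType) (A : nat) (nu : bandit_instance R A) (a : 'I_A)
  : R := \int[nu a]_x x.

(* Mean rewards lie in [0, 1], hence 0 is neutral for this maximum. *)
Definition best_mean (R : realType) (A : nat) (nu : bandit_instance R A) : R :=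
  \big[Num.max/0]_(a < A) mean_reward nu a.

(* The history I_t = (U_0, Y_1, U_1, ..., Y_t, U_t), bracketed as
   (U_0, [:: (Y_1, U_1); ...; (Y_t, U_t)]), with the product sigma-algebra. *)
Notation history R t :=
  (measurableTypeR R * t.-tuple (measurableTypeR R * measurableTypeR R))%type.

Definition extend_history (R : realType) (t : nat) (h : history R t)
    (y u : R) : history R t.+1 :=
  (h.1, [tuple of rcons h.2 (y, u)]).

(* I_t as a function of I_T; only meaningful for t <= T. *)
Definition truncate_history (R : realType) (T t : nat) (h : history R T)
  : history R t := (h.1, [tuple nth (0, 0) h.2 i | i < t]).

(* [decide pi t] maps I_t to (a_{t+1}, q_{t+1}). Measurability is with respect
   to the discrete sigma-algebra on the finite set of decisions. *)
Record strategy (R : realType) (A : nat) := Strategy {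
  decide :> forall t, history R t -> 'I_A * bool ;
  measurable_decide : forall t (D : set ('I_A * bool)),
    measurable (@decide t @^-1` D) }.

Arguments decide {R A} _ t _.

Definition uniform01 (R : realType) : probability (measurableTypeR R) R :=
  uniform_prob (@ltr01 R).

(* Given I_t = h, the pair (R_{t+1}, U_{t+1}) is distributed as the product of
   the law of the chosen arm and of the uniform law; [play_round] maps this pair
   to I_{t+1}, in which only Y_{t+1} = R_{t+1} * q_{t+1} is recorded. *)
Definition play_round (R : realType) (A : nat) (pi : strategy R A) (t : nat)
    (h : history R t) (z : measurableTypeR R * measurableTypeR R)
  : history R t.+1 :=
  extend_history h (z.1 * (decide pi t h).2%:R) z.2.

Section next_law.
Context (R : realType) (A : nat) (nu : bandit_instance R A) (pi : strategy R A).
Context (t : nat) (P : probability (history R t) R).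
Local Open Scope ereal_scope.

(* The law of I_{t+1}, if P is the law of I_t. *)
Definition next_law (S : set (history R t.+1)) : \bar R :=
  \int[P]_h (nu (decide pi t h).1 \x uniform01 R) (play_round pi h @^-1` S).

Let ext (q : bool) (x : history R t * (measurableTypeR R * measurableTypeR R)) :
  history R t.+1 := extend_history x.1 (x.2.1 * q%:R)%R x.2.2.

Let measurable_ext q : measurable_fun setT (ext q).
Proof.
apply/measurable_fun_pairP; split.
  exact: (measurableT_comp measurable_fst measurable_fst).
apply/measurable_fun_tnthP => i.
have [it|it] := ltnP i t.
- rewrite (_ : _ \o _ = fun x : history R t * _ => tnth x.1.2 (Ordinal it)).
    apply: (measurableT_comp (measurable_tnth (Ordinal it))).
    exact: (measurableT_comp measurable_snd measurable_fst).
  by apply/funext => x /=; rewrite !(tnth_nth (0, 0)%R) /= nth_rcons size_tuple it.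
- rewrite (_ : _ \o _ = fun x => (x.2.1 * q%:R, x.2.2)%R); last first.
    apply/funext => x /=; rewrite (tnth_nth (0, 0)%R) /= nth_rcons size_tuple.
    by rewrite ltnNge it /= eqn_leq it -ltnS ltn_ord.
  apply/measurable_fun_pairP; split => /=.
    apply: measurable_funM => //.
    exact: (measurableT_comp measurable_fst measurable_snd).
  exact: (measurableT_comp measurable_snd measurable_snd).
Qed.

Let measurable_play_round (h : history R t) : measurable_fun setT (play_round pi h).
Proof.
exact: (measurableT_comp (measurable_ext (decide pi t h).2)
  (measurable_pair1 h)).
Qed.

Lemma measurable_step S : measurable S ->
  measurable_fun setT (fun h : history R t =>
    (nu (decide pi t h).1 \x uniform01 R) (play_round pi h @^-1` S)).
Proof.
move=> mS _ Y mY; rewrite setTI.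
pose g (d : 'I_A * bool) (h : history R t) :=
  (nu d.1 \x uniform01 R) (xsection (ext d.2 @^-1` S) h).
have mg d : measurable_fun setT (g d).
  have mA : measurable (ext d.2 @^-1` S).
    by rewrite -[X in measurable X]setTI; exact: measurable_ext.
  pose mu : probability _ R := nu d.1 \x uniform01 R.
  exact: (measurable_fun_xsection mu mA).
rewrite (_ : _ @^-1` _ =
    \bigcup_d (decide pi t @^-1` [set d] `&` g d @^-1` Y)).
  apply: fin_bigcup_measurable => //= d _; apply: measurableI.
    exact: measurable_decide.
  by rewrite -[X in measurable X]setTI; exact: mg.
apply/seteqP; split => [h /= Yh|h [d _ [/= dE]]].
  by exists (decide pi t h) => //; split => //=; rewrite /g xsectionE.
by rewrite /g xsectionE -dE.
Qed.

Let next_law0 : next_law set0 = 0.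
Proof. by apply: integral0_eq => h _; rewrite preimage_set0 measure0. Qed.

Let next_law_ge0 S : 0 <= next_law S.
Proof. exact: integral_ge0. Qed.

Let next_law_sigma_additive : semi_sigma_additive next_law.
Proof.
move=> F mF tF mUF; rewrite [X in _ --> X](_ : _ = \int[P]_h (\sum_(n <oo)
    (nu (decide pi t h).1 \x uniform01 R) (play_round pi h @^-1` F n))).
  apply/cvg_closeP; split.
    by apply: is_cvg_nneseries => n _ _; exact: next_law_ge0.
  rewrite closeE// integral_nneseries// => n.
  exact: measurable_step.
apply: eq_integral => h _; apply/esym/cvg_lim => //.
have mp B : measurable B -> measurable (play_round pi h @^-1` B).
  by move=> mB; rewrite -[X in measurable X]setTI; exact: measurable_play_round.
rewrite preimage_bigcup; apply: measure_semi_sigma_additive.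
- by move=> n; exact: mp.
- apply/trivIsetP => i j _ _ ij; rewrite -preimage_setI.
  by move/trivIsetP : tF => /(_ i j Logic.I Logic.I ij) ->; rewrite preimage_set0.
- by rewrite -preimage_bigcup; exact: mp.
Qed.

HB.instance Definition _ := isMeasure.Build _ _ _ next_law
  next_law0 next_law_ge0 next_law_sigma_additive.

Let next_law_setT : next_law setT = 1.
Proof.
rewrite /next_law (eq_integral (cst 1)) => [|h _].
  by rewrite integral_cst// mul1e; exact: probability_setT.
rewrite preimage_setT.
exact: (@probability_setT _ _ _ (nu _ \x uniform01 R : probability _ R)).
Qed.

HB.instance Definition _ := Measure_isProbability.Build _ _ _ next_law
  next_law_setT.

End next_law.

(* The law of I_t when pi interacts with nu. *)
Fixpoint history_law (R : realType) (A : nat) (nu : bandit_instance R A)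
    (pi : strategy R A) (t : nat) : probability (history R t) R :=
  match t with
  | 0 => (uniform01 R \x \d_([tuple] : 0.-tuple _))%E
  | t'.+1 => next_law nu pi (history_law nu pi t')
  end.

(* The decision (a_{t+1}, q_{t+1}) as a random variable on the space of I_T. *)
Definition decision (R : realType) (A : nat) (pi : strategy R A) (T t : nat)
    (h : history R T) : 'I_A * bool :=
  decide pi t (truncate_history t h).

Definition n_queries (R : realType) (A : nat) (pi : strategy R A) (T : nat)
    (h : history R T) : R :=
  \sum_(t < T) (decision pi t h).2%:R.

Definition regret (R : realType) (A : nat) (nu : bandit_instance R A)
    (pi : strategy R A) (T : nat) (h : history R T) : R :=
  \sum_(t < T) (best_mean nu - mean_reward nu (decision pi t h).1).

(* Main.v *)
From HB Require Import structures.
Require Import Defs.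
From mathcomp Require Import all_boot all_order all_algebra.
From mathcomp Require Import all_classical all_reals all_analysis.
From mathcomp Require Import measurable_realfun ring lra.

(* Compare the instance P_0 whose arms are all Bernoulli(1/2) with the instances
   P_a (a < A) where arm a is Bernoulli(1/2 + e). On I_T the density of P_a with
   respect to P_0 is exp M, where M sums the log-likelihood ratios of the queried
   rewards of arm a, and E_0[- M] = k E_0[N_a] with N_a the number of queries to
   a and k = KL(Ber(1/2) | Ber(1/2 + e)) <= (8/3) e^2. If X_a is the number of
   rounds not spent on a, the pointwise bound
     exp M * X_a >= X_a / 2 - T (exp M - 1 - M)
   integrates to E_a[X_a] >= E_0[X_a] / 2 - T k E_0[N_a]; no Pinsker inequality is
   needed. Since the X_a sum to (A - 1) T and the E_0[N_a] sum to at most B, some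
   a has E_a[X_a] >= T / 12 as soon as 16 e^2 B <= A, that is, regret at least
   e T / 12 under P_a. Take e = min (1, sqrt (A / B)) / 4. *)

Set Implicit Arguments.
Unset Strict Implicit.
Unset Printing Implicit Defensive.

Import Order.TTheory GRing.Theory Num.Theory.
Local Open Scope classical_set_scope.
Local Open Scope ring_scope.
Local Open Scope ereal_scope.

(** * Integration against the law of one round *)

Lemma measurable_extend_history (R : realType) (t : nat) :
  measurable_fun setT (fun x : history R t *
    (measurableTypeR R * measurableTypeR R) =>
    extend_history x.1 x.2.1 x.2.2 : history R t.+1).
Proof.
apply/measurable_fun_pairP; split.
  exact: measurableT_comp measurable_fst measurable_fst.
apply/measurable_fun_tnthP => i; have [it|ti] := ltnP i t.
- rewrite (_ : _ \o _ = (@tnth _ _ ^~ (Ordinal it)) \o snd \o fst).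
    apply: measurableT_comp measurable_fst.
    exact: measurableT_comp (measurable_tnth _) measurable_snd.
  apply/funext => x /=; rewrite !(tnth_nth (0, 0)%R) /= nth_rcons size_tuple.
  by rewrite it.
- rewrite (_ : _ \o _ = snd) //; apply/funext => -[h [y u]] /=.
  rewrite (tnth_nth (0, 0)%R) /= nth_rcons size_tuple ltnNge ti /=.
  by rewrite eqn_leq ti -ltnS ltn_ord.
Qed.

Lemma measurable_play_round (R : realType) (A : nat) (pi : strategy R A) t
  (h : history R t) : measurable_fun setT (play_round pi h).
Proof.
rewrite (_ : play_round pi h = (fun x : history R t *
    (measurableTypeR R * measurableTypeR R) =>
    extend_history x.1 x.2.1 x.2.2) \o
  (fun z => (h, (z.1 * (decide pi t h).2%:R, z.2)%R))) //.
apply: (measurableT_comp (@measurable_extend_history R t)).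
apply/measurable_fun_pairP; split => /=; first exact: measurable_cst.
apply/measurable_fun_pairP; split => /=; last exact: measurable_snd.
by apply: measurable_funM; [exact: measurable_fst|exact: measurable_cst].
Qed.

HB.instance Definition _ (R : realType) (A : nat) (pi : strategy R A) t
    (h : history R t) :=
  isMeasurableFun.Build _ _ _ _ (play_round pi h)
    (@measurable_play_round R A pi t h).

Section integral_next_law.
Context (R : realType) (A : nat) (nu : bandit_instance R A).
Context (pi : strategy R A) (t : nat).

(* The unit factor is the parameter space required by [kcomp]. *)
Definition round_kernel (x : unit * history R t) :
    {measure set (history R t.+1) -> \bar R} :=
  distribution (nu (decide pi t x.2).1 \x uniform01 R)%E (play_round pi x.2).

Let measurable_round_kernel U : measurable U ->
  measurable_fun setT (round_kernel ^~ U).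
Proof.
move=> mU; exact: measurableT_comp (measurable_step nu pi mU) measurable_snd.
Qed.

HB.instance Definition _ := isKernel.Build _ _ _ _ R round_kernel
  measurable_round_kernel.

Let round_kernelT x : round_kernel x setT = 1.
Proof. exact: probability_setT. Qed.

HB.instance Definition _ := Kernel_isProbability.Build _ _ _ _ R round_kernel
  round_kernelT.


(** By definition [next_law nu pi P] is the composition of the constant kernel [P] with
    [round_kernel], so the integration formula for composed kernels applies up to conversion. *)
Lemma integral_next_law (P : probability (history R t) R)
    (f : history R t.+1 -> \bar R) :
    measurable_fun setT f -> (forall h, 0 <= f h) ->
  \int[next_law nu pi P]_h f h = \int[P]_h \int[round_kernel (tt, h)]_g f g.
Proof.
move=> mf f0.
pose l : R.-pker unit ~> history R t :=
  kprobability (measurable_cst (P : pprobability _ R)).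
exact: (@integral_kcomp _ _ _ _ _ _ _ l round_kernel tt f f0 mf).
Qed.

Lemma measurable_integral_round_kernel (f : history R t.+1 -> \bar R) :
    measurable_fun setT f -> (forall h, 0 <= f h) ->
  measurable_fun setT (fun h => \int[round_kernel (tt, h)]_g f g).
Proof.
move=> mf f0.
apply: (measurable_fun_integral_kernel (l := fun h => round_kernel (tt, h))) => //.
by move=> U mU; apply: measurable_step.
Qed.

(** Change of variables along [play_round], then Tonelli. The reward is the outer variable, so that
    a Bernoulli law can later be summed out. *)
Lemma integral_round_kernel (f : history R t.+1 -> \bar R) h :
    measurable_fun setT f -> (forall h, 0 <= f h) ->
  \int[round_kernel (tt, h)]_g f g = \int[nu (decide pi t h).1]_y
    \int[uniform01 R]_u f (extend_history h (y * (decide pi t h).2%:R)%R u).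
Proof.
move=> mf f0.
rewrite ge0_integral_distribution //.
apply: (@fubini_tonelli1 _ _ _ _ _ _ _ (f \o play_round pi h)).
  by apply: (measurableT_comp mf); exact: measurable_play_round.
by move=> z; exact: f0.
Qed.

End integral_next_law.

(** * Bernoulli instances *)

Section bernoulli01.
Context (R : realType) (A : nat).

(** [bernoulli_prob] lives on [bool], while reward laws live on the reals; this map transports the
    former. *)
Definition real_of_bool (b : bool) : measurableTypeR R := b%:R%R.

Let measurable_real_of_bool : measurable_fun setT real_of_bool.
Proof. by []. Qed.

HB.instance Definition _ := isMeasurableFun.Build _ _ _ _ real_of_bool
  measurable_real_of_bool.

Definition bernoulli01 (p : R) : probability (measurableTypeR R) R :=
  distribution (bernoulli_prob p) real_of_bool.

Lemma bernoulli01_itv p : bernoulli01 p `[0%R, 1%R]%classic = 1.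
Proof.
rewrite -(@probability_setT _ _ _ (bernoulli_prob p)).
congr (bernoulli_prob p _); apply/seteqP; split => // -[] _ /=.
  by rewrite /real_of_bool in_itv /= lexx ler01.
by rewrite /real_of_bool in_itv /= lexx ler01.
Qed.

Definition bernoulli_instance (p : 'I_A -> R) : bandit_instance R A :=
  BanditInstance (fun a => bernoulli01_itv (p a)).

Lemma ge0_integral_bernoulli01 (p : R) (f : measurableTypeR R -> \bar R) :
    (0 <= p <= 1)%R -> measurable_fun setT f -> (forall y, 0 <= f y) ->
  \int[bernoulli01 p]_y f y = p%:E * f 1%R + (1 - p)%:E * f 0%R.
Proof.
move=> p01 mf f0; rewrite ge0_integral_distribution //.
by rewrite integral_bernoulli_prob // => b; exact: f0.
Qed.

Lemma mean_bernoulli_instance (p : 'I_A -> R) a : (0 <= p a <= 1)%R ->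
  mean_reward (bernoulli_instance p) a = p a.
Proof.
(* The identity on the reals is not nonnegative, so this change of variables asks for integrability,
   which boundedness on [bool] provides. *)
move=> p01; rewrite /mean_reward /Rintegral integral_distribution //=.
- rewrite integral_bernoulli_prob //=; last by case.
  by rewrite /real_of_bool/= mulr0 mulr1 addr0.
- apply: measurable_bounded_integrable => //.
    exact: fin_num_fun_lty.
  exists 1%R; split => // x x1 b _; apply: le_trans (ltW x1).
  by case: b; rewrite /= /real_of_bool ?normr1 ?normr0.
Qed.

End bernoulli01.

(** * Statistics accumulated along a history, and their measurability *)

Lemma measurable_fun_finite_index d d' (T : measurableType d)
    (T' : measurableType d') (D : finType) (g : T -> D) (F : D -> T -> T') :
    (forall S : set D, measurable (g @^-1` S)) ->
    (forall i, measurable_fun setT (F i)) ->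
  measurable_fun setT (fun x => F (g x) x).
Proof.
move=> mg mF _ Y mY; rewrite setTI.
(* The preimage is cut along the finitely many values of [g], on each of which the function agrees
   with a fixed [F i]. *)
rewrite (_ : _ @^-1` _ = \bigcup_i (g @^-1` [set i] `&` F i @^-1` Y)).
  apply: fin_bigcup_measurable => [|i _]; first exact: finite_finset.
  apply: measurableI; first exact: mg.
  by rewrite -[X in measurable X]setTI; exact: mF.
by apply/seteqP; split => [x Yx|x [i _ [<-]]] //; exists (g x).
Qed.

Lemma measurable_truncate_history (R : realType) (T t : nat) :
  measurable_fun setT (@truncate_history R T t).
Proof.
apply/measurable_fun_pairP; split; first exact: measurable_fst.
apply/measurable_fun_tnthP => i; have [iT|Ti] := ltnP i T.
- rewrite (_ : _ \o _ = (@tnth _ _ ^~ (Ordinal iT)) \o snd).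
    exact: measurableT_comp (measurable_tnth _) measurable_snd.
  by apply/funext => h /=; rewrite tnth_mktuple (tnth_nth (0, 0)%R).
- rewrite (_ : _ \o _ = cst (0, 0)%R) //.
  by apply/funext => h /=; rewrite tnth_mktuple nth_default ?size_tuple.
Qed.

Lemma truncate_history_id (R : realType) t (h : history R t) :
  truncate_history t h = h.
Proof.
case: h => u0 h; congr pair; apply: eq_from_tnth => i.
by rewrite tnth_mktuple (tnth_nth (0, 0)%R).
Qed.

Lemma truncate_extend_history (R : realType) s t (h : history R t) y u :
  (s <= t)%N -> truncate_history s (extend_history h y u) = truncate_history s h.
Proof.
move=> st; congr pair; apply: eq_from_tnth => i; rewrite !tnth_mktuple /=.
by rewrite nth_rcons size_tuple (leq_trans (ltn_ord i) st).
Qed.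

Section cumul.
Context (R : realType) (A : nat) (pi : strategy R A).
Implicit Type w : 'I_A * bool -> measurableTypeR R -> R.

(** A common form for pull counts, query counts and log-likelihoods. Index [s] pairs the decision of
    round [s + 1] with the observation of that same round. *)
Definition cumul w t (h : history R t) : R :=
  (\sum_(s < t) w (decision pi s h) (tnth h.2 s).1)%R.

Lemma cumul_extend_history w t (h : history R t) y u :
  cumul w (extend_history h y u) = (cumul w h + w (decide pi t h) y)%R.
Proof.
rewrite /cumul big_ord_recr /=; congr (_ + w _ _)%R.
- apply: eq_bigr => s _; rewrite /decision truncate_extend_history 1?ltnW //.
  by rewrite !(tnth_nth (0, 0)%R) /= nth_rcons size_tuple ltn_ord.
- by rewrite /decision truncate_extend_history // truncate_history_id.
- by rewrite (tnth_nth (0, 0)%R) /= nth_rcons size_tuple ltnn eqxx.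
Qed.

Lemma measurable_decision T t (S : set ('I_A * bool)) :
  measurable (@decision R A pi T t @^-1` S).
Proof.
rewrite -[X in measurable X]setTI.
exact: measurable_truncate_history (measurable_decide pi S).
Qed.

Lemma measurable_cumul w t : (forall d, measurable_fun setT (w d)) ->
  measurable_fun setT (cumul w (t := t)).
Proof.
move=> mw; apply: measurable_sum => s.
apply: (@measurable_fun_finite_index _ _ _ _ _ (@decision R A pi t s)
  (fun d h => w d (tnth h.2 s).1)) => [S|d]; first exact: measurable_decision.
apply: measurableT_comp (mw d) _; apply: measurableT_comp measurable_fst _.
exact: measurableT_comp (measurable_tnth _) measurable_snd.
Qed.

End cumul.

(** * Change of measure and compensators for Bernoulli instances *)

Section bernoulli_round.
Context (R : realType) (A : nat) (p : 'I_A -> R).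
Hypothesis p01 : forall a, (0 <= p a <= 1)%R.
Context (pi : strategy R A) (t : nat).
Let nu := bernoulli_instance p.

(** Reward 1 is observed as the query bit and reward 0 as 0, hence the two arguments of
    [extend_history]. *)
Lemma integral_bernoulli_round (f : history R t.+1 -> \bar R) h :
    measurable_fun setT f -> (forall h, 0 <= f h) ->
  \int[round_kernel nu pi (tt, h)]_g f g =
    (p (decide pi t h).1)%:E *
      \int[uniform01 R]_u f (extend_history h (decide pi t h).2%:R%R u) +
    (1 - p (decide pi t h).1)%:E *
      \int[uniform01 R]_u f (extend_history h 0%R u).
Proof.
move=> mf f0; rewrite integral_round_kernel // ge0_integral_bernoulli01 //.
- by rewrite mul1r mul0r.
- apply: (@measurable_fun_fubini_tonelli_F _ _ _ _ _ (uniform01 R)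
    (f \o play_round pi h)).
    by apply: (measurableT_comp mf); exact: measurable_play_round.
  by move=> z; exact: f0.
- by move=> y; exact: integral_ge0.
Qed.

End bernoulli_round.

(* An unqueried round is observed as 0, whatever the arm, and must not change the
   likelihood. *)
Lemma change_of_measure (R : realType) (A : nat) (p p' : 'I_A -> R)
    (w : 'I_A * bool -> measurableTypeR R -> R) (pi : strategy R A) :
    (forall a, 0 <= p a <= 1)%R -> (forall a, 0 <= p' a <= 1)%R ->
    (forall d, measurable_fun setT (w d)) ->
    (forall a, w (a, false) 0 = 0)%R ->
    (forall a, p' a = p a * expR (w (a, true) 1))%R ->
    (forall a, 1 - p' a = (1 - p a) * expR (w (a, true) 0))%R ->
  forall t (f : history R t -> \bar R),
    measurable_fun setT f -> (forall h, 0 <= f h) ->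
  \int[history_law (bernoulli_instance p') pi t]_h f h =
  \int[history_law (bernoulli_instance p) pi t]_h
    (f h * (expR (cumul pi w h))%:E).
Proof.
move=> p01 p'01 mw wF wT1 wT0; elim => [|t IH] f mf f0.
  apply: eq_integral => h _.
  by rewrite /cumul big_ord0 expR0 mule1.
have mfe : measurable_fun setT (fun h => f h * (expR (cumul pi w h))%:E).
  apply: emeasurable_funM => //; apply/measurable_EFinP.
  by apply: measurableT_comp => //; exact: measurable_cumul.
have fe0 h : 0 <= f h * (expR (cumul pi w h))%:E.
  by apply: mule_ge0; rewrite ?lee_fin ?expR_ge0.
rewrite [LHS](integral_next_law _ _ _ mf f0).
rewrite [RHS](integral_next_law _ _ _ mfe fe0).
(* The induction hypothesis is used for the integral of [f] over the last round; a one-round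
   identity at a fixed history remains. *)
rewrite IH; last 2 first.
- exact: measurable_integral_round_kernel.
- by move=> h; exact: integral_ge0.
apply: eq_integral => h _.
rewrite !integral_bernoulli_round //.
set G := fun y => \int[uniform01 R]_u f (extend_history h y u).
have G0 y : 0 <= G y by exact: integral_ge0.
have GE y : \int[uniform01 R]_u (f (extend_history h y u) *
    (expR (cumul pi w (extend_history h y u)))%:E) =
    G y * (expR (cumul pi w h + w (decide pi t h) y))%:E.
  under eq_integral do rewrite cumul_extend_history.
  rewrite ge0_integralZr //.
  rewrite (_ : (fun u => _) = f \o (fun x : history R t *
    (measurableTypeR R * measurableTypeR R) =>
    extend_history x.1 x.2.1 x.2.2) \o (fun u => (h, (y, u)))) //.
  apply: measurableT_comp.
    by apply: (measurableT_comp mf); exact: measurable_extend_history.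
  apply/measurable_fun_pairP; split; first exact: measurable_cst.
  by apply/measurable_fun_pairP; split; [exact: measurable_cst|exact: measurable_id].
rewrite !GE -!/(G _).
case: (decide pi t h) => a [] /=.
(* Queried round: the likelihood factors turn [p a] into [p' a] and [1 - p a] into [1 - p' a]. *)
- have /andP[p'0 p'1] := p'01 a; rewrite -subr_ge0 in p'1.
  rewrite ge0_muleDl ?mule_ge0 ?lee_fin // wT0 wT1 !expRD !EFinM.
  by congr (_ + _); rewrite -!muleA; congr (_ * _); rewrite muleC muleA muleAC.
(* Unqueried round: both outcomes are observed as 0, so the two probabilities add up to 1 under
   either instance. *)
- have /andP[p0 p1] := p01 a; have /andP[p'0 p'1] := p'01 a.
  rewrite -subr_ge0 in p1; rewrite -subr_ge0 in p'1.
  rewrite wF addr0 -!ge0_muleDl ?lee_fin //.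
  by rewrite -!EFinD !subrKC !mul1e.
Qed.

(** [c d] is the conditional mean of the new weight given the decision [d], the observation being
    the query bit with probability [p d.1] and 0 otherwise. *)
Lemma integral_cumul_step (R : realType) (A : nat) (p : 'I_A -> R)
    (w : 'I_A * bool -> measurableTypeR R -> R) (c : 'I_A * bool -> R)
    (pi : strategy R A) :
    (forall a, 0 <= p a <= 1)%R ->
    (forall d, measurable_fun setT (w d)) -> (forall d y, 0 <= w d y)%R ->
    (forall d, p d.1 * w d d.2%:R + (1 - p d.1) * w d 0 = c d)%R ->
  forall t,
  \int[history_law (bernoulli_instance p) pi t.+1]_h (cumul pi w h)%:E =
  \int[history_law (bernoulli_instance p) pi t]_h (cumul pi w h)%:E +
  \int[history_law (bernoulli_instance p) pi t]_h (c (decide pi t h))%:E.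
Proof.
move=> p01 mw w0 cE t.
have tot0 s (h : history R s) : (0 <= cumul pi w h)%R.
  by apply: sumr_ge0 => i _; exact: w0.
have c0 d : (0 <= c d)%R.
  by rewrite -cE; have /andP[? ?] := p01 d.1; rewrite addr_ge0 ?mulr_ge0 ?subr_ge0.
rewrite -ge0_integralD //; last 4 first.
- by move=> h _; rewrite lee_fin.
- apply/measurable_EFinP; exact: measurable_cumul.
- by move=> h _; rewrite lee_fin.
- apply/measurable_EFinP.
  by apply: (@measurable_fun_finite_index _ _ _ _ _ (@decide _ _ pi t)
    (fun d _ => c d)) => //; exact: measurable_decide.
have mtot : measurable_fun setT (fun h : history R t.+1 => (cumul pi w h)%:E).
  by apply/measurable_EFinP; exact: measurable_cumul.
rewrite [LHS](integral_next_law _ _ _ mtot) => [|h]; last by rewrite lee_fin.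
apply: eq_integral => h _.
rewrite integral_bernoulli_round //; last by move=> g; rewrite lee_fin.
have GE y : \int[uniform01 R]_u (cumul pi w (extend_history h y u))%:E =
    (cumul pi w h + w (decide pi t h) y)%:E.
  under eq_integral do rewrite cumul_extend_history.
  rewrite integral_cst // -[RHS]mule1; congr (_ * _).
  exact: probability_setT.
rewrite !GE -cE -!EFinM -!EFinD; congr EFin; ring.
Qed.

(** Both sides have the same increments: [c], seen as a weight constant in the observation, is its
    own conditional mean. This converts expected log-likelihoods into expected query counts. *)
Lemma integral_cumul_compensator (R : realType) (A : nat) (p : 'I_A -> R)
    (w : 'I_A * bool -> measurableTypeR R -> R) (c : 'I_A * bool -> R)
    (pi : strategy R A) (t : nat) :
    (forall a, 0 <= p a <= 1)%R ->
    (forall d, measurable_fun setT (w d)) -> (forall d y, 0 <= w d y)%R ->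
    (forall d, p d.1 * w d d.2%:R + (1 - p d.1) * w d 0 = c d)%R ->
  \int[history_law (bernoulli_instance p) pi t]_h (cumul pi w h)%:E =
  \int[history_law (bernoulli_instance p) pi t]_h
    (cumul pi (fun d _ => c d) h)%:E.
Proof.
move=> p01 mw w0 cE.
have c0 d : (0 <= c d)%R.
  by rewrite -cE; have /andP[? ?] := p01 d.1; rewrite addr_ge0 ?mulr_ge0 ?subr_ge0.
elim: t => [|t IH].
  by apply: eq_integral => h _; rewrite /cumul !big_ord0.
rewrite (integral_cumul_step _ p01 mw w0 cE) IH.
apply/esym/integral_cumul_step => // d; ring.
Qed.

(* With s = exp (M / 2) >= 1 + M / 2, exp M - 1 - M >= (s - 1)^2, and
   s^2 + (s - 1)^2 >= 1 / 2. *)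
Lemma half_le_expR_mul (R : realType) (M X T : R) : (0 <= X <= T)%R ->
  (X / 2 + T * (1 + M) <= expR M * X + T * expR M)%R.
Proof.
move=> /andP[X0 XT].
have sq : expR M = (expR (M / 2) * expR (M / 2))%R by rewrite -expRD; congr expR; lra.
have s1 := expR_ge1Dx (M / 2); rewrite sq; set s := expR _ in s1 *.
(* The first product gives [T * (1 + M) <= T * (2 * s - 1)]. The remaining gap is [(T - X) * (s -
   1)^2 + X * (2 * s - 1)^2 / 2], a combination of the other two. *)
have : (0 <= T * (s - (1 + M / 2)))%R by apply: mulr_ge0; lra.
have : (0 <= (T - X) * ((s - 1) * (s - 1)))%R.
  by apply: mulr_ge0; [lra | rewrite -expr2 sqr_ge0].
have : (0 <= X * ((2 * s - 1) * (2 * s - 1)))%R.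
  by apply: mulr_ge0; [lra | rewrite -expr2 sqr_ge0].
nra.
Qed.

Lemma integral_bounded_fin_num d (T : measurableType d) (R : realType)
    (P : probability T R) (f : T -> R) (c : R) :
    measurable_fun setT f -> (forall x, 0 <= f x <= c)%R ->
  \int[P]_x (f x)%:E \is a fin_num.
Proof.
move=> mf fc; rewrite ge0_fin_numE; last first.
  by apply: integral_ge0 => x _; rewrite lee_fin; have /andP[] := fc x.
apply: le_lt_trans (ltry c).
rewrite -[leRHS]mule1 -(@probability_setT _ _ _ P) -integral_cst //.
apply: ge0_le_integral => //=.
- by move=> x _; rewrite lee_fin; have /andP[] := fc x.
- exact/measurable_EFinP.
- by move=> x _; rewrite lee_fin; have /andP[] := fc x.
Qed.

(** * The perturbed instances, their likelihood ratios and their divergence *)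

Section perturbed_instance.
Context (R : realType) (A : nat) (e : R).
Hypothesis e_itv : (0 <= e <= 4^-1)%R.

Definition perturbed (a : 'I_A) : 'I_A -> R :=
  fun b => (2^-1 + e * (b == a)%:R)%R.

Lemma perturbed_itv a b : (0 <= perturbed a b <= 1)%R.
Proof. by rewrite /perturbed; case: (b == a); move/andP: e_itv => [? ?] /=; lra. Qed.

Definition fair : 'I_A -> R := fun=> 2^-1%R.

Lemma fair_itv b : (0 <= fair b <= 1)%R.
Proof. by rewrite /fair; lra. Qed.

Lemma best_mean_perturbed a :
  best_mean (bernoulli_instance (perturbed a)) = (2^-1 + e)%R.
Proof.
move/andP: (e_itv) => [e0 e1].
apply/le_anti/andP; split.
- apply/bigmax_leP; split=> [|b _]; first lra.
  rewrite mean_bernoulli_instance ?perturbed_itv // /perturbed.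
  by case: (b == a); rewrite ?mulr1 ?mulr0; lra.
- apply: (bigmax_sup a) => //.
  by rewrite mean_bernoulli_instance ?perturbed_itv // /perturbed eqxx mulr1.
Qed.

Lemma regret_perturbed (pi : strategy R A) T a (h : history R T) :
  regret (bernoulli_instance (perturbed a)) pi h =
  (e * cumul pi (fun d _ => (d.1 != a)%:R) h)%R.
Proof.
rewrite /regret best_mean_perturbed /cumul mulr_sumr; apply: eq_bigr => t _.
rewrite mean_bernoulli_instance ?perturbed_itv // /perturbed.
by case: (_ == a) => /=; lra.
Qed.

(* Queried rewards are almost surely 0 or 1, so any y <> 1 is treated as 0. *)
Definition log_likelihood (a : 'I_A) (d : 'I_A * bool) (y : measurableTypeR R) : R :=
  if d == (a, true) then
    if y == 1%R then ln (1 + 2 * e)%R else ln (1 - 2 * e)%R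
  else 0%R.

Lemma measurable_log_likelihood a d : measurable_fun setT (log_likelihood a d).
Proof.
rewrite /log_likelihood; case: (d == _); last exact: measurable_cst.
apply: measurable_fun_ifT => //.
exact: measurable_fun_eqr.
Qed.

(** Makes [1 - log_likelihood] a nonnegative weight, as [integral_cumul_compensator] requires. *)
Lemma log_likelihood_le1 a d y : (log_likelihood a d y <= 1)%R.
Proof.
move/andP: (e_itv) => [e0 e1].
rewrite /log_likelihood; case: (d == _) => //; case: (y == _).
  by apply: (@le_trans _ _ (2 * e)%R); [apply: le_ln1Dx; lra | lra].
by apply: (@le_trans _ _ (- (2 * e))%R); [apply: le_ln1Dx; lra | lra].
Qed.

(* The Kullback-Leibler divergence of Bernoulli(1/2 + e) from Bernoulli(1/2). *)
Definition divergence : R := (- (ln (1 + 2 * e) + ln (1 - 2 * e)) / 2)%R.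

Lemma divergence_ge0 : (0 <= divergence)%R.
Proof.
move/andP: (e_itv) => [e0 e1].
have l1 : (ln (1 + 2 * e) <= 2 * e)%R by apply: le_ln1Dx; lra.
have l2 : (ln (1 - 2 * e) <= - (2 * e))%R by apply: le_ln1Dx; lra.
by rewrite /divergence; lra.
Qed.

(** With [z = 1 - 4 * e ^+ 2], the divergence is [ln z^-1 / 2], at most
    [(z^-1 - 1) / 2 = 2 * e ^+ 2 / z]; [e <= 1/4] gives [z >= 3/4], hence the factor 8/3. *)
Lemma divergence_le : (divergence <= 8 / 3 * e ^+ 2)%R.
Proof.
move/andP: (e_itv) => [e0 e1].
have e2 : (e ^+ 2 <= 16^-1)%R by rewrite expr2; nra.
rewrite /divergence -lnM ?posrE; [|lra|lra].
rewrite (_ : (1 + 2 * e) * (1 - 2 * e) = 1 - 4 * e ^+ 2)%R; last ring.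
set z := (1 - 4 * e ^+ 2)%R.
have z0 : (3 / 4 <= z)%R by rewrite /z; lra.
rewrite -lnV ?posrE; last lra.
have zV0 : (0 < z^-1)%R by rewrite invr_gt0; lra.
have /le_ln1Dx : (-1 < z^-1 - 1)%R by lra.
rewrite subrKC => lnz.
apply: le_trans (_ : (z^-1 - 1) / 2 <= _)%R; first lra.
have zi : (z^-1 <= 4 / 3)%R.
  by rewrite -[leRHS]invrK lef_pV2 ?posrE; lra.
have -> : (z^-1 - 1 = z^-1 * (4 * e ^+ 2))%R.
  by rewrite /z; field; rewrite -/z; lra.
have := sqr_ge0 e; nra.
Qed.
End perturbed_instance.

Lemma integral_probability_cst d (T : measurableType d) (R : realType)
  (P : probability T R) (r : R) : \int[P]_x r%:E = r%:E.
Proof. by rewrite -[RHS]mule1 -(@probability_setT _ _ _ P) -integral_cst. Qed.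

Lemma natr_bool_itv (R : realType) (b : bool) : (0 <= (b%:R : R) <= 1)%R.
Proof. by case: b; rewrite /= ?lexx ler01. Qed.

(** * Comparison of a perturbed instance with the fair one *)

Section comparison.
Context (R : realType) (A : nat) (e : R).
Hypothesis e_itv : (0 <= e <= 4^-1)%R.
Context (pi : strategy R A) (T : nat).

Local Notation P0 := (history_law (bernoulli_instance (@fair R A)) pi T).
Local Notation Pa a := (history_law (bernoulli_instance (perturbed e a)) pi T).
Local Notation X a := (cumul pi (fun d _ => (d.1 != a)%:R%R) (t := T)).
Local Notation N a := (cumul pi (fun d _ => (d == (a, true))%:R%R) (t := T)).

Lemma cumul_itv (w : 'I_A * bool -> measurableTypeR R -> R) t (h : history R t) :
  (forall d y, 0 <= w d y <= 1)%R -> (0 <= cumul pi w h <= t%:R)%R.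
Proof.
move=> w01; apply/andP; split.
  by apply: sumr_ge0 => s _; have /andP[] := w01 (decision pi s h) (tnth h.2 s).1.
rewrite -[leRHS](@mulr_natl R 1) mulr1 -[t in leRHS]card_ord -sumr_const.
by apply: ler_sum => s _; have /andP[] := w01 (decision pi s h) (tnth h.2 s).1.
Qed.

Lemma fin_num_integral_cumul (nu : bandit_instance R A)
    (w : 'I_A * bool -> measurableTypeR R -> R) :
    (forall d, measurable_fun setT (w d)) -> (forall d y, 0 <= w d y <= 1)%R ->
  \int[history_law nu pi T]_h (cumul pi w h)%:E \is a fin_num.
Proof.
move=> mw w01; apply: (@integral_bounded_fin_num _ _ _ _ _ T%:R%R).
  exact: measurable_cumul.
by move=> h; exact: cumul_itv.
Qed.

(* Subtracting the log-likelihood from 1 keeps the integrands nonnegative. *)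
Lemma integral_log_likelihood (a : 'I_A) :
  \int[P0]_h (cumul pi (fun d y => 1 - log_likelihood e a d y)%R h)%:E =
  T%:R%:E + (divergence e)%:E * \int[P0]_h (N a h)%:E.
Proof.
have div0 := divergence_ge0 e_itv.
(* Under the fair law, [1 - log_likelihood] has conditional mean 1, plus the divergence when arm [a]
   is queried. *)
rewrite (@integral_cumul_compensator _ _ _ _
  (fun d => 1 + divergence e * (d == (a, true))%:R)%R) //; last 4 first.
- exact: fair_itv.
- move=> d; apply: measurable_funB; first exact: measurable_cst.
  exact: measurable_log_likelihood.
- by move=> d y; rewrite subr_ge0 log_likelihood_le1.
- move=> [b q]; rewrite /log_likelihood /fair /divergence; case: eqVneq => /= [[_ ->]|_].
    by rewrite eqxx eq_sym oner_eq0; lra.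
  by lra.
have mN : measurable_fun setT (fun h : history R T => (N a h)%:E).
  by apply/measurable_EFinP; apply: measurable_cumul.
have N0 h : (0 <= N a h)%R.
  by have /andP[] := cumul_itv h (fun d _ => natr_bool_itv R (d == (a, true))).
rewrite -ge0_integralZl //; last by move=> h _; rewrite lee_fin.
(* The constant [T] becomes an integral, so that the two sides can be compared pointwise. *)
rewrite -[Z in Z%:E + _]mulr1 EFinM -(@probability_setT _ _ _ P0).
rewrite -integral_cst // -ge0_integralD //=; last 2 first.
- by move=> h _; rewrite -EFinM lee_fin mulr_ge0.
- exact: measurable_funeM.
apply: eq_integral => h _; rewrite -EFinM -EFinD; congr EFin.
rewrite /cumul big_split /= -mulr_sumr sumr_const card_ord; congr (_ + _)%R.
Qed.

Lemma perturbed_comparison (a : 'I_A) :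
  (2^-1)%:E * \int[P0]_h (X a h)%:E <=
  \int[Pa a]_h (X a h)%:E + (T%:R * divergence e)%:E * \int[P0]_h (N a h)%:E.
Proof.
pose l := log_likelihood e a; pose M := cumul pi l (t := T).
have /andP[e0 e1] := e_itv.
have ml d : measurable_fun setT (l d) by exact: measurable_log_likelihood.
have mX : measurable_fun setT (fun h : history R T => (X a h)%:E).
  by apply/measurable_EFinP; apply: measurable_cumul.
have X_itv (h : history R T) : (0 <= X a h <= T%:R)%R.
  exact: (cumul_itv h (fun d _ => natr_bool_itv R (d.1 != a))).
have X0 h : (0 <= X a h)%R by have /andP[] := X_itv h.
have mexp : measurable_fun setT (fun h => (expR (M h))%:E).
  by apply/measurable_EFinP; apply: measurableT_comp => //; exact: measurable_cumul.
have change f : measurable_fun setT f -> (forall h, 0 <= f h) ->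
    \int[Pa a]_h f h = \int[P0]_h (f h * (expR (M h))%:E).
  (* For a queried reward of arm [a] the ratios are [(1/2 + e) / (1/2) = 1 + 2 * e] at 1 and
     [1 - 2 * e] at 0, both positive as [e <= 1/4]. *)
  apply: change_of_measure => //; first exact: fair_itv.
  - by move=> b; exact: perturbed_itv.
  - by move=> b; rewrite /l /log_likelihood xpair_eqE andbF.
  - move=> b; rewrite /l /log_likelihood xpair_eqE andbT eqxx /perturbed /fair.
    by case: eqP => _; rewrite ?expR0 ?lnK ?posrE /=; lra.
  - move=> b; rewrite /l /log_likelihood xpair_eqE andbT [0%R == _]eq_sym oner_eq0.
    by rewrite /perturbed /fair; case: eqP => _; rewrite ?expR0 ?lnK ?posrE /=; lra.
have exp1 : \int[P0]_h (expR (M h))%:E = 1.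
  rewrite -(@probability_setT _ _ _ (Pa a)) -[RHS]mul1e -integral_cst // change //.
  by apply: eq_integral => h _; rewrite mul1e.
pose W := cumul pi (fun d y => 1 - l d y)%R (t := T).
have WE h : (W h = T%:R - M h)%R.
  by rewrite /W /M /cumul big_split /= sumrN sumr_const card_ord.
have W0 h : (0 <= W h)%R.
  by apply: sumr_ge0 => s _; rewrite subr_ge0 log_likelihood_le1.
have mW : measurable_fun setT (fun h => (W h)%:E).
  apply/measurable_EFinP; apply: measurable_cumul => d.
  by apply: measurable_funB; [exact: measurable_cst|exact: ml].
have T0 : (0 <= T%:R :> R)%R by [].
have TT0 : (0 <= T%:R * (1 + T%:R) :> R)%R by rewrite mulr_ge0 // addr_ge0.
(* This is [half_le_expR_mul] with [T * W = T * (T - M)] added to both sides: [M] can take either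
   sign, whereas every term is now nonnegative. *)
have : \int[P0]_h ((2^-1)%:E * (X a h)%:E + (T%:R * (1 + T%:R))%:E) <=
    \int[P0]_h ((X a h)%:E * (expR (M h))%:E +
      (T%:R%:E * (expR (M h))%:E + T%:R%:E * (W h)%:E)).
  apply: ge0_le_integral => //.
  - by move=> h _; rewrite -EFinM -EFinD lee_fin addr_ge0 // mulr_ge0.
  - by apply: emeasurable_funD => //; exact: measurable_funeM.
  - apply: emeasurable_funD; first exact: emeasurable_funM.
    by apply: emeasurable_funD; exact: measurable_funeM.
  - move=> h _; rewrite -!EFinM -!EFinD lee_fin.
    by have := half_le_expR_mul (M h) (X_itv h); rewrite WE; lra.
rewrite ge0_integralD //; last 2 first.
- by move=> h _; rewrite -EFinM lee_fin mulr_ge0.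
- exact: measurable_funeM.
rewrite ge0_integralZl //; last by move=> h _; rewrite lee_fin.
rewrite integral_probability_cst.
rewrite ge0_integralD //; last 4 first.
- by move=> h _; rewrite -EFinM lee_fin mulr_ge0 ?expR_ge0.
- exact: emeasurable_funM.
- by move=> h _; rewrite -!EFinM -EFinD lee_fin addr_ge0 ?mulr_ge0 ?expR_ge0.
- by apply: emeasurable_funD; exact: measurable_funeM.
rewrite -(change _ mX); last by move=> h; rewrite lee_fin.
rewrite ge0_integralD //; last 3 first.
- exact: measurable_funeM.
- by move=> h _; rewrite -!EFinM lee_fin mulr_ge0.
- exact: measurable_funeM.
rewrite !ge0_integralZl //; last by move=> h _; rewrite lee_fin.
(* The last two terms integrate to [T + T * (T + k * E_0[N_a])], with [k] the divergence; all but [T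
   * k * E_0[N_a]] cancels against [T * (1 + T)], and finiteness of the integrals allows the
   cancellation. *)
rewrite exp1 mule1 integral_log_likelihood.
have fX nu : \int[history_law nu pi T]_h (X a h)%:E \is a fin_num.
  apply: fin_num_integral_cumul => // d y; exact: natr_bool_itv.
have fN : \int[P0]_h (N a h)%:E \is a fin_num.
  apply: fin_num_integral_cumul => // d y; exact: natr_bool_itv.
rewrite -(fineK (fX (bernoulli_instance (@fair R A)))).
rewrite -(fineK (fX (bernoulli_instance (perturbed e a)))) -(fineK fN).
rewrite -!EFinM -!EFinD -?EFinM -?EFinD !lee_fin.
lra.
Qed.

End comparison.

(** * Averaging over the arms *)

Section regret_lower_bound.
Context (R : realType) (A T : nat) (B e : R) (pi : strategy R A).
Hypothesis A_ge2 : (2 <= A)%N.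
Hypothesis e_itv : (0 <= e <= 4^-1)%R.
Hypothesis eB : (16 * e ^+ 2 * B <= A%:R)%R.

Local Notation P0 := (history_law (bernoulli_instance (@fair R A)) pi T).
Local Notation Pa a := (history_law (bernoulli_instance (perturbed e a)) pi T).
Local Notation X a := (cumul pi (fun d _ => (d.1 != a)%:R%R) (t := T)).
Local Notation N a := (cumul pi (fun d _ => (d == (a, true))%:R%R) (t := T)).

Hypothesis queries : 'E_P0[n_queries pi (T := T)] <= B%:E.

(** Each round avoids exactly [A - 1] arms. *)
Lemma sum_pulls (h : history R T) :
  (\sum_(a < A) X a h = (A%:R - 1) * T%:R)%R.
Proof.
rewrite /cumul exchange_big /= mulrC mulr_natl -[T in RHS]card_ord -sumr_const.
apply: eq_bigr => s _; set d := decision _ _ _.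
rewrite (bigD1 d.1) //= eqxx add0r.
rewrite (eq_bigr (fun=> 1%R)) => [|a ad]; last by rewrite eq_sym ad.
rewrite sumr_const cardC1 card_ord -subn1 natrB //; exact: leq_trans A_ge2.
Qed.

Lemma sum_queries (h : history R T) :
  (\sum_(a < A) N a h = n_queries pi h)%R.
Proof.
rewrite /cumul exchange_big /=; apply: eq_bigr => s _.
case: (decision _ _ _) => b q /=; rewrite (bigD1 b) //= big1 ?addr0.
  by rewrite xpair_eqE eqxx; case: q.
by move=> a ab; rewrite xpair_eqE eq_sym (negbTE ab).
Qed.

(** If every [E_a[X_a]] were below [T / 12], summing the comparisons would give [(A - 1) * T / 2 < A
    * T / 12 + A * T / 6 = A * T / 4], contradicting [A >= 2]. *)
Lemma exists_large_regret : exists a,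
  (e * T%:R / 12)%:E <= 'E_(Pa a)[regret (bernoulli_instance (perturbed e a)) pi (T := T)].
Proof.
have /andP[e0 e1] := e_itv.
have fX nu a : \int[history_law nu pi T]_h (X a h)%:E \is a fin_num.
  by apply: fin_num_integral_cumul => // d y; exact: natr_bool_itv.
have fN a : \int[P0]_h (N a h)%:E \is a fin_num.
  by apply: fin_num_integral_cumul => // d y; exact: natr_bool_itv.
have X0 a (h : history R T) : (0 <= X a h)%R.
  by have /andP[] := cumul_itv pi h (fun d _ => natr_bool_itv R (d.1 != a)).
have N0 a (h : history R T) : (0 <= N a h)%R.
  by have /andP[] := cumul_itv pi h (fun d _ => natr_bool_itv R (d == (a, true))).
have mX a : measurable_fun setT (fun h : history R T => (X a h)%:E).
  by apply/measurable_EFinP; apply: measurable_cumul.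
have mN a : measurable_fun setT (fun h : history R T => (N a h)%:E).
  by apply/measurable_EFinP; apply: measurable_cumul.
pose x a := fine (\int[P0]_h (X a h)%:E).
pose x' a := fine (\int[Pa a]_h (X a h)%:E).
pose n a := fine (\int[P0]_h (N a h)%:E).
have cmp a : (x a / 2 <= x' a + T%:R * divergence e * n a)%R.
  have := perturbed_comparison e_itv pi T a.
  rewrite -(fineK (fX (bernoulli_instance (@fair R A)) a)).
  rewrite -(fineK (fX (bernoulli_instance (perturbed e a)) a)) -(fineK (fN a)).
  by rewrite -!EFinM -!EFinD lee_fin mulrC.
have sumx : (\sum_(a < A) x a = (A%:R - 1) * T%:R)%R.
  apply: EFin_inj; rewrite -sumEFin.
  under eq_bigr do rewrite fineK //.
  rewrite -ge0_integral_sum //; last by move=> a h _; rewrite lee_fin.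
  under eq_integral do rewrite sumEFin sum_pulls.
  exact: integral_probability_cst.
have sumn : (\sum_(a < A) n a <= B)%R.
  rewrite -lee_fin -sumEFin; apply: le_trans queries; rewrite expectation.unlock.
  under eq_bigr do rewrite fineK //.
  rewrite -ge0_integral_sum //; last by move=> a h _; rewrite lee_fin.
  by under eq_integral do rewrite sumEFin sum_queries.
have sumn0 : (0 <= \sum_(a < A) n a)%R.
  apply: sumr_ge0 => a _; apply: fine_ge0; apply: integral_ge0 => h _.
  by rewrite lee_fin.
have [a xa] : exists a, (T%:R / 12 <= x' a)%R.
  apply: contrapT => /forallNP small.
  have A0 : (0 < A)%N by exact: leq_trans A_ge2.
  have : (\sum_(a < A) x' a < \sum_(a < A) (T%:R / 12))%R.
    apply: ltr_sum => [|a _]; first by apply/hasP; exists (Ordinal A0); rewrite ?mem_index_enum.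
    by have /negP := small a; rewrite -ltNge.
  rewrite sumr_const card_ord -mulr_natr.
  have : (\sum_(a < A) x a / 2 <=
      \sum_(a < A) (x' a + T%:R * divergence e * n a))%R by exact: ler_sum.
  rewrite big_split /= -mulr_suml -mulr_sumr sumx.
  have A2 : (2 <= A%:R :> R)%R by rewrite ler_nat.
  have T0 : (0 <= T%:R :> R)%R by [].
  (* [8 / 3 * e ^+ 2 * B] is one sixth of the quantity that [eB] bounds by [A]. *)
  have de : (divergence e * \sum_(a < A) n a <= A%:R / 6)%R.
    apply: (@le_trans _ _ (8 / 3 * e ^+ 2 * B)%R); last first.
      have := eB; set z := (16 * _ * _)%R.
      by rewrite (_ : 8 / 3 * e ^+ 2 * B = z / 6)%R; [lra | rewrite /z; field].
    apply: (@le_trans _ _ (8 / 3 * e ^+ 2 * \sum_(a < A) n a)%R).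
      by rewrite ler_wpM2r // divergence_le.
    by rewrite ler_wpM2l // mulr_ge0 ?sqr_ge0.
  have := ler_wpM2l T0 de; have := ler_wpM2l T0 A2; nra.
exists a; rewrite expectation.unlock.
under eq_integral do rewrite regret_perturbed // EFinM.
rewrite ge0_integralZl //; last by move=> h _; rewrite lee_fin.
rewrite -(fineK (fX _ _)) -EFinM lee_fin -mulrA.
by rewrite ler_wpM2l.
Qed.

End regret_lower_bound.

(** * Choice of the gap [e] *)

Unset Implicit Arguments.

Theorem proposition1 (R : realType) (T A : nat) (B : R) (pi : strategy R A)
  (hA : (2 <= A)%N) (hB : (0 <= B)%R)
  (hq : forall nu : bandit_instance R A,
    'E_(history_law nu pi T)[n_queries pi (T := T)] <= B%:E) :
  exists nu : bandit_instance R A,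
    (140^-1)%:E *
      Order.min (T%:R%:E * sqrte (A%:R%:E / B%:E)) T%:R%:E
    <= 'E_(history_law nu pi T)[regret nu pi (T := T)].
Proof.
set m := Order.min _ _.
have T0 : (0 <= T%:R :> R)%R by [].
suff [e [e_itv eB me]] : exists e : R, [/\ (0 <= e <= 4^-1)%R,
    (16 * e ^+ 2 * B <= A%:R)%R & m <= (4 * e * T%:R)%:E].
  have [a Ha] := exists_large_regret hA e_itv eB (hq _).
  exists (bernoulli_instance (perturbed e a)); apply: le_trans Ha.
  (* The regret [e * T / 12] would support the constant 1/48; 1/140 follows from
     [4 / 140 <= 1 / 12]. *)
  apply: (@le_trans _ _ ((140^-1)%:E * (4 * e * T%:R)%:E)).
    by rewrite lee_pmul2l // lte_fin; lra.
  rewrite -EFinM lee_fin; have /andP[e0 _] := e_itv.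
  by have := mulr_ge0 e0 T0; lra.
(* The case [B <= A] contains [B = 0]; there [e = 1/4] gives [16 * e ^+ 2 = 1], and [m] is bounded
   by its second argument [T]. *)
have [BA|AB] := leP B A%:R%R.
  exists 4^-1%R; split; [lra | lra |].
  by rewrite /m ge_min; apply/orP; right; rewrite lee_fin; lra.
have A0 : (0 < A%:R :> R)%R by rewrite ltr0n; exact: leq_trans hA.
have B0 : (0 < B)%R by lra.
(* This value makes [16 * e ^+ 2 * B] equal to [A]; it is at most 1/4 because [A < B]. *)
exists (Num.sqrt (A%:R / B) / 4)%R; split.
- rewrite divr_ge0 ?sqrtr_ge0 //= ler_pdivrMr // mulVf //.
  by rewrite -[leRHS]sqrtr1 ler_sqrt // ler_pdivrMr // mul1r ltW.
- rewrite expr_div_n sqr_sqrtr; last by rewrite divr_ge0 ?ltW.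
  by rewrite le_eqVlt; apply/orP; left; apply/eqP; field; rewrite gt_eqF.
- rewrite /m ge_min; apply/orP; left.
  (* As [B] is nonzero, the extended inverse is the real one. *)
  by rewrite inver gt_eqF // -EFinM lee_fin; lra.
Qed.
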